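(* Consider an importance function $V$, level size $\Delta>0$ and an unbiased splitting mechanism $(q,r,w)$, and define $\bar W:D\to\mathbb{R}$ by $$\bar W(y)=\frac{\log E\,r(M)}{\Delta}\,V(y).$$ Let $x\in D\setminus(A\cup B)$ with $V(x)\ge 0$, and let $x_n\in D\setminus(A\cup B)$ be initial conditions with $x_n\to x$. Suppose there exists $y\in D\setminus(A\cup B)$ such that $\bar W(y)>0$ and $$\bar W(x)-\bar W(y)>\mathcal{J}(x,y).$$ Assume that $z\mapsto\mathcal{J}(x,z)$ is continuous at $z=y$. For $\delta>0$ let $\tilde p^n_\delta(x_n)$ be the probability that $X^n$ enters the ball of radius $\delta$ about $y$ before entering $A$, given $X^n_0=x_n$, and assume that for every $\delta>0$ $$\liminf_{n\to\infty}\frac1n\log\tilde p^n_\delta(x_n)\ge-\inf_{z:|z-y|<\delta}\mathcal{J}(x,z).$$ Then the corresponding splitting algorithm is not stable.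
   Context: Setting: $D\subset\mathbb{R}^d$ is a domain, and for each $n$, $\{X^n_i\}_{i\ge 0}$ is a discrete-time, $D$-valued Markov process with stationary transition probabilities. $A,B$ are disjoint subsets of $D$. $E_y$ denotes expectation for initial condition $y$. $L:\mathbb{R}^d\times\mathbb{R}^d\to[0,\infty]$ is a given function (the local rate function), and for $y,z\in D$ $$\mathcal{J}(y,z)=\inf\int_0^t L(\phi(s),\dot\phi(s))\,ds,$$ the infimum being over all $t<\infty$ and all absolutely continuous $\phi:[0,t]\to D$ with $\phi(0)=y$, $\phi(t)=z$. Importance function and levels: $V:D\to\mathbb{R}$ is continuous with $V(y)\le 0$ for all $y\in B$, and $\Delta>0$. Let $L_z=\{y\in D: V(y)\le z\}$, $C^n_0=B$, $C^n_j=L_{(j-1)\Delta/n}$ for $j\ge 1$, and $l^n(y)=\min\{j\ge 0: y\in C^n_j\}$. Splitting mechanism $(q,r,w)$: $q$ is a probability distribution on $\{1,\dots,J\}$; for each $j\in\{1,\dots,J\}$, $r(j)$ is a nonnegative integer with $r(j)\le R<\infty$ and $w(j)=(w_1(j),\dots,w_{r(j)}(j))\in\mathbb{R}_+^{r(j)}$. $M$ denotes a random variable with law $q$. The mechanism is unbiased if $E\sum_{i=1}^{r(M)}w_i(M)=1$. Splitting algorithm: generation $0$ consists of one particle at $x_n$ with weight $1$. For $r=1,\dots,l^n(x_n)$, each particle of generation $r-1$, at position $\xi$ with weight $\omega$, is treated independently of all other particles as follows. Run a sample $Z_i$ of the process with the law of $X^n$ started at $Z_0=\xi$, and let $\tau=\inf\{i\ge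 0: Z_i\in A\cup C^n_{l^n(x_n)-r}\}$. If $\tau<\infty$ and $Z_\tau\notin A$, draw an independent $M$ with law $q$ and add to generation $r$ exactly $r(M)$ particles located at $Z_\tau$, the $k$-th with weight $w_k(M)\,\omega$. Otherwise the particle produces no descendants. (Here $r$ as generation index and $r(\cdot)$ as offspring number are different objects.) Let $N^n_r$ be the number of particles in generation $r$. Stability: the splitting algorithm is called stable if the expected total number of particles grows subexponentially in $n$, i.e. $\limsup_{n\to\infty}\frac1n\log E_{x_n}\big[\sum_{r=0}^{l^n(x_n)}N^n_r\big]\le 0$. *)

(* Defs.v *)
From HB Require Import structures.
From mathcomp Require Import all_boot all_order all_algebra.
From mathcomp Require Import all_classical all_reals all_analysis.

Set Implicit Arguments.
Unset Strict Implicit.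
Unset Printing Implicit Defensive.

Import Order.TTheory GRing.Theory Num.Theory.
Import numFieldNormedType.Exports.

Local Open Scope classical_set_scope.
Local Open Scope ring_scope.

(* R^d with its Borel sigma-algebra; convertible to 'rV[R]_d. *)
Notation borel_rV R d := (g_sigma_algebraType (@open 'rV[R]_d)).

(* The library norm on 'rV is the sup norm. *)
Definition enorm {R : realType} {d : nat} (v : 'rV[R]_d) : R :=
  Num.sqrt (\sum_(i < d) v 0 i ^+ 2).

Definition eball {R : realType} {d : nat} (y : 'rV[R]_d) (delta : R) :
  set 'rV[R]_d := [set z | enorm (z - y) < delta].

Definition abs_continuous {R : realType} {d : nat} (t : R)
    (phi : R -> 'rV[R]_d) : Prop :=
  forall eps : R, 0 < eps -> exists2 delta : R, 0 < delta &
    forall (m : nat) (a b : 'I_m -> R),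
      (forall i, [/\ 0 <= a i, a i <= b i & b i <= t]) ->
      trivIset [set: 'I_m] (fun i => `]a i, b i[%classic) ->
      \sum_(i < m) (b i - a i) < delta ->
      \sum_(i < m) enorm (phi (b i) - phi (a i)) < eps.

(* An absolutely continuous phi is differentiable almost everywhere on [0, t],
   so the default value of derive1 at the other points (and its two-sidedness
   at 0 and t) does not affect the integral. *)
Definition action_cost {R : realType} {d : nat} (D : set 'rV[R]_d)
    (L : 'rV[R]_d -> 'rV[R]_d -> \bar R) (y z : 'rV[R]_d) : \bar R :=
  ereal_inf [set c : \bar R | exists t : R, exists phi : R -> 'rV[R]_d,
    [/\ [/\ 0 <= t, phi 0 = y & phi t = z],
        abs_continuous t phi,
        (forall s, 0 <= s <= t -> D (phi s)) &
        c = (\int[lebesgue_measure]_(s in `[0%R, t])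
               L (phi s) (derive1 phi s))%E]].

(* mp_proba y is the law P_y under which the process starts at y; nothing is
   required of it, or of mp_kernel y, for y outside D. *)
Record markov_process {R : realType} {d : nat} (D : set 'rV[R]_d) :=
  MarkovProcess {
  mp_disp : measure_display;
  mp_space : measurableType mp_disp;
  mp_proba : 'rV[R]_d -> probability mp_space R;
  mp_X : nat -> mp_space -> borel_rV R d;
  mp_kernel : R.-pker (borel_rV R d) ~> (borel_rV R d);
  mp_measurable : forall i, measurable_fun [set: mp_space] (mp_X i);
  mp_state : forall i omega, D (mp_X i omega);
  mp_start : forall y, D y -> mp_proba y [set omega | mp_X 0 omega = y] = 1%E;
  mp_markov : forall y, D y ->
    forall (m : nat) (a : nat -> set (borel_rV R d)) (b : set (borel_rV R d)),
      (forall i, measurable (a i)) -> measurable b ->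
      let past := [set omega | forall i, (i <= m)%N -> a i (mp_X i omega)] in
      mp_proba y (past `&` [set omega | b (mp_X m.+1 omega)]) =
      (\int[mp_proba y]_(omega in past) mp_kernel (mp_X m omega) b)%E
}.

Arguments mp_proba {R d D} _.
Arguments mp_X {R d D} _.
Arguments mp_kernel {R d D} _.

(* The type 'I_sm_J stands for {1, ..., J}. *)
Record splitting_mechanism (R : realType) := SplittingMechanism {
  sm_J : nat;
  sm_q : 'I_sm_J -> R;
  sm_q_ge0 : forall j, 0 <= sm_q j;
  sm_q_sum1 : \sum_j sm_q j = 1;
  sm_r : 'I_sm_J -> nat;
  sm_R : nat;
  sm_r_le : forall j, (sm_r j <= sm_R)%N;
  sm_w : forall j, 'I_(sm_r j) -> R;
  sm_w_ge0 : forall j i, 0 <= sm_w (j := j) i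
}.
Arguments sm_w {R} s j.

Definition mech_mean {R : realType} (S : splitting_mechanism R)
    (f : 'I_(sm_J S) -> R) : R := \sum_j sm_q j * f j.

Definition unbiased {R : realType} (S : splitting_mechanism R) : Prop :=
  mech_mean (fun j => \sum_(i < sm_r j) sm_w S j i) = 1.

Definition mean_offspring {R : realType} (S : splitting_mechanism R) : R :=
  mech_mean (fun j : 'I_(sm_J S) => (sm_r j)%:R).

Definition first_time (P : set nat) : option nat :=
  xget None [set Some i | i in [set i | P i /\ forall k, P k -> (i <= k)%N]].

Definition level_set {R : realType} {d : nat} (D B : set 'rV[R]_d)
    (V : 'rV[R]_d -> R) (Delta : R) (n j : nat) : set 'rV[R]_d :=
  if j is j'.+1 then [set y | D y /\ V y <= j'%:R * Delta / n%:R] else B.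

(* The default 0 is only reached for n = 0 or for points outside D. *)
Definition level {R : realType} {d : nat} (D B : set 'rV[R]_d)
    (V : 'rV[R]_d -> R) (Delta : R) (n : nat) (y : 'rV[R]_d) : nat :=
  odflt 0%N (first_time [set j | level_set D B V Delta n j y]).

Section splitting.
Context {R : realType} {d : nat} {D : set 'rV[R]_d}.
Variables (X : markov_process D) (A : set 'rV[R]_d) (C : nat -> set 'rV[R]_d).
Variables (S : splitting_mechanism R) (l : nat) (x0 : 'rV[R]_d).

(* Genealogical labels: the root is [::], and k :: u is the potential k-th child
   of u, so that size u is the generation of u. *)
Notation label := (seq 'I_(sm_R S)).

(* Position and weight of the k-th descendant, if it exists, of a particle of
   weight wt with run z and mechanism choice j, stopped on A or on target. *)
Definition offspring (target : set 'rV[R]_d) (z : nat -> 'rV[R]_d)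
    (j : 'I_(sm_J S)) (k : 'I_(sm_R S)) (wt : R) : option ('rV[R]_d * R) :=
  if first_time [set i | (A `|` target) (z i)] is Some tau then
    if `[< A (z tau) >] then None
    else omap (fun i : 'I_(sm_r j) => (z tau, sm_w S j i * wt))
              (insub (k : nat))
  else None.

Section particles.
Context {T : Type}.
Variables (Z : label -> nat -> T -> 'rV[R]_d) (M : label -> T -> 'I_(sm_J S)).

(* Position and weight of the particle labelled u; None if there is no such
   particle. *)
Fixpoint particle (omega : T) (u : label) : option ('rV[R]_d * R) :=
  match u with
  | [::] => Some (x0, 1)
  | k :: v =>
      if particle omega v is Some (_, wt) then
        offspring (C (l - (size v).+1)) (fun i => Z v i omega) (M v omega) k wt
      else None
  end.

Definition exists_particle (u : label) : set T :=
  [set omega | isSome (particle omega u)].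

(* The default value x0 is not used for existing particles. *)
Definition position (u : label) (omega : T) : 'rV[R]_d :=
  if particle omega u is Some (xi, _) then xi else x0.

(* Sigma-algebra generated by the runs and the mechanism choices of the existing
   particles of generations < g. *)
Definition history (g : nat) : set (set T) :=
  <<s [set H : set T | exists2 v : label, (size v < g)%N &
        (exists i, exists2 a : set (borel_rV R d), measurable a &
           H = exists_particle v `&` [set omega | a (Z v i omega)]) \/
        (exists j, H = exists_particle v `&` [set omega | M v omega = j])] >>.

Definition population (g : nat) (omega : T) : nat :=
  #|[set u : g.-tuple 'I_(sm_R S) | isSome (particle omega u)]|.

Definition total_population (omega : T) : nat :=
  \sum_(0 <= g < l.+1) population g omega.

End particles.

(* A realization of the algorithm on some probability space: sr_Z u and sr_M u
   are the run and the mechanism choice of particle u (unconstrained when u does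
   not exist). sr_law: given the history of the generations < g, the particles u
   of generation g are independent, and for each of them the run has the law of X
   started at the position of u and is independent of the choice, of law q. *)
Record splitting_run := SplittingRun {
  sr_disp : measure_display;
  sr_space : measurableType sr_disp;
  sr_proba : probability sr_space R;
  sr_Z : label -> nat -> sr_space -> borel_rV R d;
  sr_M : label -> sr_space -> 'I_(sm_J S);
  sr_Z_measurable : forall u i, measurable_fun [set: sr_space] (sr_Z u i);
  sr_M_measurable : forall u j, measurable [set omega | sr_M u omega = j];
  sr_law : forall (g m : nat) (U : seq label) (H : set sr_space)
      (a : label -> nat -> set (borel_rV R d)) (j : label -> 'I_(sm_J S)),
    (g < l)%N -> uniq U -> (forall u, u \in U -> size u = g) ->
    (forall u i, measurable (a u i)) ->
    history sr_Z sr_M g H ->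
    (forall u, u \in U -> H `<=` exists_particle sr_Z sr_M u) ->
    sr_proba (H `&` [set omega | forall u, u \in U ->
      (forall i, (i <= m)%N -> a u i (sr_Z u i omega)) /\
      sr_M u omega = j u]) =
    (\int[sr_proba]_(omega in H) (\prod_(u <- U)
       (sm_q (j u) * fine (mp_proba X (position sr_Z sr_M u omega)
         [set eta | forall i, (i <= m)%N -> a u i (mp_X X i eta)])))%:E)%E
}.

Definition expected_total (rho : splitting_run) : \bar R :=
  'E_(sr_proba rho)[fun omega =>
    (total_population (@sr_Z rho) (@sr_M rho) omega)%:R].

End splitting.

Definition exp_rate {R : realType} (p : nat -> \bar R) (n : nat) : \bar R :=
  ((n%:R^-1)%:E * lne (p n))%E.

(* T n is the expected total number of particles. *)
Definition stable {R : realType} (T : nat -> \bar R) : Prop :=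
  (limn_esup (exp_rate T) <= 0)%E.

Definition enters_before {R : realType} {d : nat} {D : set 'rV[R]_d}
    (X : markov_process D) (G A : set 'rV[R]_d) : set (mp_space X) :=
  [set omega | exists2 i, G (mp_X X i omega) &
                 forall k, (k <= i)%N -> ~ A (mp_X X k omega)].
Arguments enters_before {R d D} X G A _.

(* Main.v *)
(** The expected number of particles of generation [g] is [m ^ g] times the
    probability that the process reaches the [g]-th level before [A], where [m]
    is the mean number of offspring: given their history, particles branch
    independently of their runs, and concatenated runs form a path of the
    process. Since [m > 1], particles proliferate along any path on which [V]
    decreases: a ball about [y] lies inside the levels passed on the way to it,
    about [n * (V x - V y) / Delta] of them, and is entered before [A] with
    probability at least [exp (- n * J x y)] to leading exponential order, so
    that the expected number of particles at the last of these levels grows at a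
    rate of at least [Wbar x - Wbar y - J x y > 0].

    The strong Markov property is only needed as an inequality: with [h z] the
    probability, started at [z], of entering the ball before [A] within a given
    number of steps, the expected sum of [h] over the particles of a generation
    is multiplied by at least [m] from one generation to the next. *)

Require Import Defs.
From HB Require Import structures.
From mathcomp Require Import all_boot all_order all_algebra.
From mathcomp Require Import all_classical all_reals all_analysis.
From mathcomp Require Import finmap measurable_realfun.
From mathcomp Require Import zify ring lra.

Set Implicit Arguments.
Unset Strict Implicit.
Unset Printing Implicit Defensive.

Import Order.TTheory GRing.Theory Num.Theory.
Import numFieldNormedType.Exports.

Local Open Scope classical_set_scope.
Local Open Scope ring_scope.

(** * Functionals on nonnegative measurable functions *)

Section monotone_functionals.
Context {disp : measure_display} {T : measurableType disp} {R : realType}.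
Local Open Scope ereal_scope.
Implicit Types f g : T -> \bar R.

Definition ge0_mfun f : Prop :=
  (forall x, 0 <= f x) /\ measurable_fun [set: T] f.

(** The properties of an integral used by the approximation argument of [eq_mfunct]. They survive
    composition with kernels and multiplication by indicators, so identities between path integrals
    only have to be checked on indicators of the last position. *)
Record monotone_functional (Phi : (T -> \bar R) -> \bar R) : Prop := {
  mfunct_ge0 : forall f, ge0_mfun f -> 0 <= Phi f;
  mfunctD : forall f g, ge0_mfun f -> ge0_mfun g ->
    Phi (f \+ g) = Phi f + Phi g;
  mfunctZ : forall (r : R) f, (0 <= r)%R -> ge0_mfun f ->
    Phi (fun x => r%:E * f x) = r%:E * Phi f;
  mfunct_le : forall f g, ge0_mfun f -> ge0_mfun g ->
    (forall x, f x <= g x) -> Phi f <= Phi g;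
  mfunct_cvg : forall (f_ : (T -> \bar R)^nat) f,
    (forall n, ge0_mfun (f_ n)) -> ge0_mfun f ->
    (forall x, {homo f_^~ x : n m / (n <= m)%N >-> n <= m}) ->
    (forall x, f_ n x @[n --> \oo] --> f x) ->
    Phi (f_ n) @[n --> \oo] --> Phi f }.

Lemma ge0_mfun0 : ge0_mfun (cst 0).
Proof. by split => //; exact: measurable_cst. Qed.

Lemma ge0_mfunZ (r : R) f : (0 <= r)%R -> ge0_mfun f ->
  ge0_mfun (fun x => r%:E * f x).
Proof.
move=> r0 [f0 mf]; split; first by move=> x; rewrite mule_ge0.
exact: measurable_funeM.
Qed.

Lemma ge0_mfun_indic (a : set T) : measurable a ->
  ge0_mfun (fun x => (\1_a x)%:E).
Proof.
move=> ma; split; first by move=> x; rewrite lee_fin.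
by apply/measurable_EFinP; exact: measurable_indic.
Qed.

Lemma ge0_mfunM_indic (a : set T) f : measurable a -> ge0_mfun f ->
  ge0_mfun (fun x => (\1_a x)%:E * f x).
Proof.
move=> ma [f0 mf]; split; first by move=> x; rewrite mule_ge0 ?lee_fin.
by apply: emeasurable_funM => //; exact: (ge0_mfun_indic ma).2.
Qed.

Lemma ge0_mfun_sum (I : Type) (s : seq I) (f : I -> T -> \bar R) :
  (forall i, ge0_mfun (f i)) -> ge0_mfun (fun x => \sum_(i <- s) f i x).
Proof.
move=> mf; split; first by move=> x; apply: sume_ge0 => i _; exact: (mf i).1.
by apply: emeasurable_sum => i; exact: (mf i).2.
Qed.

Lemma mfunct0 Phi : monotone_functional Phi -> Phi (cst 0) = 0.
Proof.
move=> hP; have := mfunctZ hP (lexx 0%R) ge0_mfun0; rewrite mul0e => {2}<-.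
by congr Phi; apply/funext => x; rewrite mul0e.
Qed.

Lemma mfunct_sum Phi (I : Type) (s : seq I) (f : I -> T -> \bar R) :
  monotone_functional Phi -> (forall i, ge0_mfun (f i)) ->
  Phi (fun x => \sum_(i <- s) f i x) = \sum_(i <- s) Phi (f i).
Proof.
move=> hP mf; elim: s => [|i s IHs].
  rewrite big_nil -[RHS](mfunct0 hP); congr Phi.
  by apply/funext => x; rewrite big_nil.
rewrite big_cons -IHs -(mfunctD hP)//; last exact: ge0_mfun_sum.
by congr Phi; apply/funext => x; rewrite big_cons.
Qed.

Import HBNNSimple.

(** Simple functions approximate [f] from below: linearity reduces each of them to indicators, and
    [mfunct_cvg] passes to the limit. *)
Lemma eq_mfunct Phi Psi :
  monotone_functional Phi -> monotone_functional Psi ->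
  (forall a, measurable a ->
    Phi (fun x => (\1_a x)%:E) = Psi (fun x => (\1_a x)%:E)) ->
  forall f, ge0_mfun f -> Phi f = Psi f.
Proof.
move=> hP hQ eqPQ f [f0 mf].
pose f_ := nnsfun_approx measurableT mf.
have mf_ n : ge0_mfun (EFin \o f_ n).
  split; first by move=> x; rewrite lee_fin.
  exact/measurable_EFinP.
have nd_f x : {homo (fun n => (EFin \o f_ n) x) : n m / (n <= m)%N >-> n <= m}.
  by move=> n m nm; rewrite lee_fin; exact/lefP/nd_nnsfun_approx.
have cvf x : (EFin \o f_ n) x @[n --> \oo] --> f x.
  by apply: cvg_nnsfun_approx => // y _; exact: f0.
have eqf n : Phi (EFin \o f_ n) = Psi (EFin \o f_ n).
  (* [Num.max r 0] equals [r] on the range of [f_ n] and makes the summand nonnegative for every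
     real [r], as [mfunct_sum] asks. *)
  have -> : EFin \o f_ n = fun x => \sum_(r <- fset_set (range (f_ n)))
      (Num.max r 0)%:E * (\1_(f_ n @^-1` [set r]) x)%:E.
    apply/funext => x /=; rewrite fimfunE fsbig_finite//= -sumEFin.
    rewrite big_seq [RHS]big_seq; apply: eq_bigr => r.
    rewrite in_fset_set// => /set_mem[y _ <-].
    by rewrite max_l// EFinM.
  have mr r : ge0_mfun (fun x => (Num.max r 0)%:E *
                                 (\1_(f_ n @^-1` [set r]) x)%:E).
    apply: ge0_mfunZ; first by rewrite le_max lexx orbT.
    exact: ge0_mfun_indic.
  rewrite (mfunct_sum _ hP)// (mfunct_sum _ hQ)//; apply: eq_bigr => r _.
  have r0 : (0 <= Num.max r 0)%R by rewrite le_max lexx orbT.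
  have mi : ge0_mfun (fun x => (\1_(f_ n @^-1` [set r]) x)%:E).
    exact: ge0_mfun_indic.
  by rewrite (mfunctZ hP r0 mi) (mfunctZ hQ r0 mi) eqPQ.
have cP := mfunct_cvg hP mf_ (conj f0 mf) nd_f cvf.
have cQ := mfunct_cvg hQ mf_ (conj f0 mf) nd_f cvf.
rewrite -(cvg_lim _ cP)// -(cvg_lim _ cQ)//.
by congr (lim (_ @ \oo)); apply/funext => n; exact: eqf.
Qed.

End monotone_functionals.

Section functional_instances.
Context {d1 d2 : measure_display} {T1 : measurableType d1}
  {T2 : measurableType d2} {R : realType}.
Local Open Scope ereal_scope.

Lemma mfunct_integral (mu : {measure set T2 -> \bar R}) (E : set T2)
    (Z : T2 -> T1) : measurable E -> measurable_fun setT Z ->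
  monotone_functional (fun f : T1 -> \bar R => \int[mu]_(w in E) f (Z w)).
Proof.
move=> mE mZ.
have mc (f : T1 -> \bar R) : ge0_mfun f -> measurable_fun E (f \o Z).
  by move=> [_ mf]; apply: measurable_funTS; exact: measurableT_comp.
split.
- by move=> f [f0 _]; apply: integral_ge0.
- move=> f g mf mg; rewrite ge0_integralD//.
  + by move=> x _; exact: mf.1.
  + exact: mc.
  + by move=> x _; exact: mg.1.
  + exact: mc.
- move=> r f r0 mf; rewrite ge0_integralZl//.
  + exact: mc.
  + by move=> x _; exact: mf.1.
- move=> f g mf mg fg; apply: ge0_le_integral => //.
  + by move=> x _; exact: mf.1.
  + exact: mc.
  + exact: mc.
- move=> f_ f mf_ mf nd cvf.
  have -> : \int[mu]_(w in E) f (Z w) =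
            \int[mu]_(w in E) limn (fun n => f_ n (Z w)).
    by apply: eq_integral => w _; apply/esym/cvg_lim => //; exact: cvf.
  apply: (cvg_monotone_convergence mE (g' := fun n w => f_ n (Z w))).
  + by move=> n; exact: mc.
  + by move=> n x _; exact: (mf_ n).1.
  + by move=> x _; exact: nd.
Qed.

End functional_instances.

(** * Transition operators with killing *)

Section kernel_operators.
Context {disp : measure_display} {T : measurableType disp} {R : realType}.
Variable K : R.-pker T ~> T.
Local Open Scope ereal_scope.
Implicit Types f g : T -> \bar R.

Definition kernel_op f (x : T) : \bar R := \int[K x]_y f y.

Lemma mfunct_kernel_op x : monotone_functional (kernel_op^~ x).
Proof. exact: (@mfunct_integral _ _ _ _ _ (K x) setT id). Qed.

Lemma ge0_mfun_kernel_op f : ge0_mfun f -> ge0_mfun (kernel_op f).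
Proof.
move=> mf; split; first by move=> x; exact: (mfunct_ge0 (mfunct_kernel_op x)).
apply: measurable_fun_integral_kernel; [|exact: mf.1|exact: mf.2].
by move=> U mU; exact: measurable_kernel.
Qed.

Lemma mfunct_comp_kernel Phi : monotone_functional Phi ->
  monotone_functional (fun f => Phi (kernel_op f)).
Proof.
move=> hP; split.
- by move=> f mf; apply: (mfunct_ge0 hP); exact: ge0_mfun_kernel_op.
- move=> f g mf mg; rewrite -(mfunctD hP); try exact: ge0_mfun_kernel_op.
  by congr Phi; apply/funext => x; rewrite (mfunctD (mfunct_kernel_op x)).
- move=> r f r0 mf; rewrite -(mfunctZ hP)//; last exact: ge0_mfun_kernel_op.
  by congr Phi; apply/funext => x; rewrite (mfunctZ (mfunct_kernel_op x)).
- move=> f g mf mg fg; apply: (mfunct_le hP); try exact: ge0_mfun_kernel_op.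
  by move=> x; exact: (mfunct_le (mfunct_kernel_op x)).
- move=> f_ f mf_ mf nd cvf.
  apply: (mfunct_cvg hP (f_ := fun n => kernel_op (f_ n))).
  + by move=> n; exact: ge0_mfun_kernel_op.
  + exact: ge0_mfun_kernel_op.
  + move=> x n m nm; apply: (mfunct_le (mfunct_kernel_op x)) => //.
    by move=> y; exact: nd.
  + by move=> x; exact: (mfunct_cvg (mfunct_kernel_op x)).
Qed.

Lemma mfunct_comp_indic Phi (a : set T) : measurable a ->
  monotone_functional Phi ->
  monotone_functional (fun f => Phi (fun x => (\1_a x)%:E * f x)).
Proof.
move=> ma hP.
have i0 x : 0 <= (\1_a x)%:E :> \bar R by rewrite lee_fin.
have mi f : ge0_mfun f -> ge0_mfun (fun x => (\1_a x)%:E * f x).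
  exact: ge0_mfunM_indic.
split.
- by move=> f mf; apply: (mfunct_ge0 hP); exact: mi.
- move=> f g mf mg; rewrite -(mfunctD hP); [|exact: mi|exact: mi].
  congr Phi; apply/funext => x /=; rewrite ge0_muleDr//.
    exact: mf.1.
  exact: mg.1.
- move=> r f r0 mf; rewrite -(mfunctZ hP)//; last exact: mi.
  by congr Phi; apply/funext => x; rewrite muleCA.
- move=> f g mf mg fg; apply: (mfunct_le hP); [exact: mi|exact: mi|].
  by move=> x; rewrite lee_wpmul2l.
- move=> f_ f mf_ mf nd cvf.
  apply: (mfunct_cvg hP (f_ := fun n x => (\1_a x)%:E * f_ n x)).
  + by move=> n; exact: mi.
  + exact: mi.
  + by move=> x n m nm; rewrite lee_wpmul2l//; exact: nd.
  + by move=> x; apply: cvgeZl => //; exact: cvf.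
Qed.

Lemma mfunctZ_comp Phi (r : R) : (0 <= r)%R -> monotone_functional Phi ->
  monotone_functional (fun f => r%:E * Phi f).
Proof.
move=> r0 hP; split.
- by move=> f mf; rewrite mule_ge0// (mfunct_ge0 hP).
- move=> f g mf mg; rewrite (mfunctD hP)// ge0_muleDr//.
    exact: (mfunct_ge0 hP).
  exact: (mfunct_ge0 hP).
- by move=> s f s0 mf; rewrite (mfunctZ hP)// muleCA.
- by move=> f g mf mg fg; rewrite lee_wpmul2l// (mfunct_le hP).
- by move=> f_ f mf_ mf nd cvf; apply: cvgeZl => //; exact: (mfunct_cvg hP).
Qed.

(** Killing acts before the transition: [iter t (killed_op W) f x] is the expectation of [f(X_t)],
    started at [x], on the event that [X_0, ..., X_(t-1)] avoid [W]; the position [X_t] itself is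
    unrestricted. *)
Definition killed_op (W : set T) f : T -> \bar R :=
  fun x => (\1_(~` W) x)%:E * kernel_op f x.

Lemma mfunct_comp_killed Phi W : measurable W -> monotone_functional Phi ->
  monotone_functional (fun f => Phi (killed_op W f)).
Proof.
move=> mW hP.
exact: (mfunct_comp_kernel (mfunct_comp_indic (measurableC mW) hP)).
Qed.

Lemma ge0_mfun_killed W f : measurable W -> ge0_mfun f ->
  ge0_mfun (killed_op W f).
Proof.
move=> mW mf; apply: ge0_mfunM_indic; first exact: measurableC.
exact: ge0_mfun_kernel_op.
Qed.

Lemma ge0_mfun_iter_killed W t f : measurable W -> ge0_mfun f ->
  ge0_mfun (iter t (killed_op W) f).
Proof. by move=> mW mf; elim: t => //= t IHt; exact: ge0_mfun_killed. Qed.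

Lemma mfunct_comp_iter_killed Phi W t : measurable W ->
  monotone_functional Phi ->
  monotone_functional (fun f => Phi (iter t (killed_op W) f)).
Proof.
move=> mW; elim: t Phi => [//|t IHt] Phi hP.
exact: (IHt (fun f => Phi (killed_op W f)) (mfunct_comp_killed mW hP)).
Qed.

Lemma mfunct_killed W x : measurable W ->
  monotone_functional (fun f => killed_op W f x).
Proof.
move=> mW; have i0 : (0 <= \1_(~` W) x :> R)%R by [].
exact: (mfunctZ_comp i0 (mfunct_kernel_op x)).
Qed.

(** For [f] vanishing off [W] this is the expectation of [f] at the first entrance into [W],
    restricted to entrance times less than [M]. *)
Definition killed_sum (W : set T) (M : nat) f (x : T) : \bar R :=
  \sum_(0 <= t < M) iter t (killed_op W) f x.

Lemma ge0_mfun_killed_sum W M f : measurable W -> ge0_mfun f ->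
  ge0_mfun (killed_sum W M f).
Proof.
by move=> mW mf; apply: ge0_mfun_sum => t; exact: ge0_mfun_iter_killed.
Qed.

Lemma killed_sum_rec W M f x : measurable W -> ge0_mfun f ->
  killed_sum W M.+1 f x = f x + killed_op W (killed_sum W M f) x.
Proof.
move=> mW mf; rewrite /killed_sum big_nat_recl//; congr (_ + _).
rewrite (mfunct_sum _ (mfunct_killed x mW))// => t.
exact: ge0_mfun_iter_killed.
Qed.

Lemma killed_sum_ndecr W f x : measurable W -> ge0_mfun f ->
  {homo (fun M => killed_sum W M f x) : m n / (m <= n)%N >-> m <= n}.
Proof.
move=> mW mf m n mn; rewrite /killed_sum (big_cat_nat (leq0n m) mn)/= leeDl//.
by apply: sume_ge0 => t _; exact: (ge0_mfun_iter_killed _ _ _).1.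
Qed.

End kernel_operators.

(** * Euclidean balls and Borel sets *)

Section euclidean_borel.
Context {R : realType} {d : nat}.

Lemma open_eball (y : 'rV[R]_d) (delta : R) : open (eball y delta).
Proof.
have -> : eball y delta = (fun z => enorm (z - y)) @^-1` [set r | r < delta].
  by [].
apply: open_comp; last exact: open_lt.
move=> z _; rewrite /continuous_at /enorm.
apply: (@cvg_comp _ _ _ (fun z : 'rV[R]_d => \sum_(i < d) (z - y) 0 i ^+ 2)
  Num.sqrt); last exact: sqrt_continuous.
apply: (@cvg_big _ _ _ _ _ _ _ (nbhs z) _
  (fun i (z : 'rV[R]_d) => (z - y) 0 i ^+ 2)
  (fun i => (z - y) 0 i ^+ 2)) => [|i _]; first exact: add_continuous.
apply: (@cvg_comp _ _ _ (fun z : 'rV[R]_d => (z - y) 0 i) (fun r => r ^+ 2));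
  last exact: exprn_continuous.
apply: (@cvg_comp _ _ _ (fun z : 'rV[R]_d => z - y) (fun v => v 0 i));
  last exact: coord_continuous.
by apply: cvgB; [exact: cvg_id|exact: cvg_cst].
Qed.

Lemma eball_center (y : 'rV[R]_d) (delta : R) : 0 < delta -> eball y delta y.
Proof.
move=> d0; rewrite /eball /= /enorm subrr big1 ?sqrtr0// => i _.
by rewrite mxE expr0n.
Qed.

(** The sup norm is at most the Euclidean norm, so a sup-norm ball inside [P] contains the Euclidean
    ball of the same radius. *)
Lemma nbhs_eball (y : 'rV[R]_d) (P : set 'rV[R]_d) : nbhs y P ->
  exists2 delta : R, 0 < delta & eball y delta `<=` P.
Proof.
move=> /nbhs_ballP[e /= e0 eP]; exists e => // z zy; apply: eP; split => // i j.
rewrite ord1 /ball /=; apply: le_lt_trans zy.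
rewrite distrC /enorm -sqrtr_sqr ler_wsqrtr//.
have := lexx ((z - y) 0 j ^+ 2); rewrite {1}mxE mxE => /le_trans; apply.
rewrite (bigD1 j)//= lerDl; apply: sumr_ge0 => k _; exact: sqr_ge0.
Qed.

Lemma open_borel (U : set 'rV[R]_d) :
  open U -> measurable (U : set (borel_rV R d)).
Proof. by move=> oU; exact: sub_sigma_algebra. Qed.

Lemma set1_borel (y : borel_rV R d) : measurable [set y].
Proof.
rewrite -[X in measurable X]setCK; apply: measurableC; apply: open_borel.
rewrite openC; apply: accessible_closed_set1; apply: hausdorff_accessible.
exact: norm_hausdorff.
Qed.

End euclidean_borel.

Lemma integralI_indic {d : measure_display} {T : measurableType d}
    {R : realType} (mu : {measure set T -> \bar R}) (E P : set T)
    (f : T -> \bar R) :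
  (\int[mu]_(x in E `&` P) f x = \int[mu]_(x in E) ((\1_P x)%:E * f x))%E.
Proof.
rewrite integral_mkcondr; apply: eq_integral => x _.
by rewrite patchE indicE; case: ifP => _; rewrite ?mul1e ?mul0e.
Qed.

(** * Entrance probabilities with a finite horizon *)

Section entrance.
Context {disp : measure_display} {T : measurableType disp} {R : realType}.
Variable K : R.-pker T ~> T.
Local Open Scope ereal_scope.

Lemma kernel_op_le1 (f : T -> \bar R) x : ge0_mfun f ->
  (forall y, f y <= 1) -> kernel_op K f x <= 1.
Proof.
move=> mf f1; have m1 : ge0_mfun (cst 1 : T -> \bar R).
  by split => //; exact: measurable_cst.
apply: le_trans (mfunct_le (mfunct_kernel_op K x) mf m1 f1) _.
by rewrite /kernel_op integral_cst// mul1e prob_kernel.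
Qed.

(* The probability of entering [G] before [A] at a time less than [M]. *)
Definition entrance (A G : set T) (M : nat) : T -> \bar R :=
  killed_sum K (A `|` G) M (fun x => (\1_(G `\` A) x)%:E).

Variables A G : set T.
Hypotheses (mA : measurable A) (mG : measurable G).

Let mI : ge0_mfun (fun x => (\1_(G `\` A) x)%:E : \bar R).
Proof. by apply: ge0_mfun_indic; exact: measurableD. Qed.

Lemma ge0_mfun_entrance M : ge0_mfun (entrance A G M).
Proof. by apply: ge0_mfun_killed_sum => //; exact: measurableU. Qed.

Lemma entrance_rec M x : entrance A G M.+1 x = (\1_(G `\` A) x)%:E +
  (\1_(~` (A `|` G)) x)%:E * kernel_op K (entrance A G M) x.
Proof. by rewrite /entrance killed_sum_rec//; exact: measurableU. Qed.

(** In [entrance_rec] the two indicators have disjoint supports and the kernel has mass one, so the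
    bound passes from [M] to [M.+1]. *)
Lemma entrance_le1 M x : entrance A G M x <= 1.
Proof.
elim: M x => [|M IHM] x; first by rewrite /entrance /killed_sum big_geq.
have K1 := kernel_op_le1 x (ge0_mfun_entrance M) IHM.
rewrite entrance_rec !indicE.
rewrite in_setC in_setU in_setD; case: (x \in A) => /=.
  by rewrite andbF mul0e adde0 lee_fin ler01.
by case: (x \in G) => /=; rewrite ?mul0e ?adde0 ?add0e ?mul1e.
Qed.

(* Since [G] is contained in [C], the process has to enter [C] first. *)
Lemma entrance_via (C : set T) M' M x : measurable C -> G `<=` C ->
  (M' <= M)%N ->
  entrance A G M' x <=
  killed_sum K (A `|` C) M' (fun y => (\1_(C `\` A) y)%:E * entrance A G M y) x.
Proof.
move=> mC GC; have mW : measurable (A `|` C) by exact: measurableU.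
have mf : ge0_mfun (fun y => (\1_(C `\` A) y)%:E * entrance A G M y).
  by apply: ge0_mfunM_indic; [exact: measurableD|exact: ge0_mfun_entrance].
elim: M' x => [|M' IHM] x M'M.
  by rewrite /entrance /killed_sum !big_geq.
have ndM := killed_sum_ndecr K x (measurableU _ _ mA mG) mI M'M.
rewrite killed_sum_rec// /killed_op.
have s0 := (ge0_mfun_kernel_op K (ge0_mfun_killed_sum K M' mW mf)).1 x.
(* Started in [A], the left side vanishes. Started in [C] outside [A], the right side is [entrance]
   with the longer horizon [M]. Elsewhere both sides make one transition and the induction
   hypothesis applies. *)
have [xA|xA] := boolP (x \in A).
  have -> : entrance A G M'.+1 x = 0.
    rewrite entrance_rec !indicE in_setC in_setU in_setD xA.
    by rewrite /= andbF mul0e adde0.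
  by rewrite adde_ge0// ?mule_ge0// ?lee_fin//; exact: (ge0_mfun_entrance M).1.
have [xC|xC] := boolP (x \in C).
  rewrite !indicE in_setC in_setU in_setD xC xA orbT /= mul1e mul0e adde0.
  exact: ndM.
have xG : x \in G = false.
  by apply/negbTE/negP => /set_mem/GC/mem_set; exact/negP.
rewrite entrance_rec !indicE !in_setC !in_setU !in_setD.
rewrite (negbTE xC) (negbTE xA) xG /= mul0e !add0e !mul1e.
apply: (mfunct_le (mfunct_kernel_op K x)) => [||y].
- exact: ge0_mfun_entrance.
- exact: ge0_mfun_killed_sum.
- by apply: IHM; exact: ltnW.
Qed.

End entrance.

(** * Path probabilities of the process *)

Section process_law.
Context {R : realType} {d : nat} {D : set 'rV[R]_d} (X : markov_process D).
Local Open Scope ereal_scope.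
Implicit Types (W A G : set (borel_rV R d)) (f : borel_rV R d -> \bar R).

Definition avoids W (t : nat) : set (mp_space X) :=
  [set w | forall i, (i < t)%N -> ~ W (mp_X X i w)].

Lemma measurable_mp_X i (b : set (borel_rV R d)) : measurable b ->
  measurable (mp_X X i @^-1` b).
Proof.
by move=> mb; rewrite -[_ @^-1` _]setTI; exact: mp_measurable.
Qed.

Lemma measurable_avoids W t : measurable W -> measurable (avoids W t).
Proof.
move=> mW; have -> : avoids W t =
    \bigcap_(i in [set i | (i < t)%N]) (mp_X X i @^-1` (~` W)).
  by apply/seteqP; split => w /= h i; exact: h.
apply: bigcap_measurableType => i _.
by apply: measurable_mp_X; exact: measurableC.
Qed.

Lemma avoidsS W t :
  avoids W t.+1 = avoids W t `&` (mp_X X t @^-1` (~` W)).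
Proof.
apply/seteqP; split => w /=.
  by move=> h; split => [i it|]; apply: h => //; exact: ltnW.
by move=> [h1 h2] i; rewrite ltnS leq_eqVlt => /predU1P[->|/h1].
Qed.

(** Induction on [t] for all [f] at once: the Markov property integrates out the last transition,
    which replaces [f] by [killed_op W f] at time [t]. *)
Lemma integral_avoids W t f y : D y -> measurable W -> ge0_mfun f ->
  \int[mp_proba X y]_(w in avoids W t) f (mp_X X t w) =
  iter t (killed_op (mp_kernel X) W) f y.
Proof.
move=> Dy mW; elim: t f => [|t IHt] f mf.
  have -> : avoids W 0 = setT by apply/seteqP; split.
  have mX0 : measurable [set w | mp_X X 0 w = y].
    exact: (@measurable_mp_X 0%N _ (set1_borel y)).
  (* The process starts at [y] almost surely, so the integrand may be replaced by a constant. *)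
  transitivity (\int[mp_proba X y]_w cst (f y) w).
    apply: ae_eq_integral => //.
    - exact: (measurableT_comp mf.2 (@mp_measurable _ _ _ X 0%N)).
    - exists (~` [set w | mp_X X 0 w = y]); split.
      + exact: measurableC.
      + by rewrite [LHS]probability_setC// mp_start// subee.
      + by apply: subsetC => w /= -> _.
  by rewrite integral_cst//= probability_setT mule1.
rewrite iterSr -IHt; last exact: ge0_mfun_killed.
have mX i := @mp_measurable _ _ _ X i.
transitivity (\int[mp_proba X y]_(w in avoids W t.+1)
                 kernel_op (mp_kernel X) f (mp_X X t w)); last first.
  rewrite avoidsS integralI_indic; apply: eq_integral => w _.
  by rewrite /killed_op.
apply: (@eq_mfunct _ _ _
  (fun f => \int[mp_proba X y]_(w in avoids W t.+1) f (mp_X X t.+1 w))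
  (fun f => \int[mp_proba X y]_(w in avoids W t.+1)
     kernel_op (mp_kernel X) f (mp_X X t w))) => //.
- by apply: mfunct_integral => //; exact: measurable_avoids.
- apply: (@mfunct_comp_kernel _ _ _ (mp_kernel X)
    (fun f => \int[mp_proba X y]_(w in avoids W t.+1) f (mp_X X t w))).
  by apply: mfunct_integral => //; exact: measurable_avoids.
- move=> b mb.
  (* The past up to and including time [t] is the event [avoids W t.+1]. *)
  have := @mp_markov _ _ _ X y Dy t (fun=> ~` W) b (fun=> measurableC mW) mb.
  move=> /= mk.
  transitivity (mp_proba X y (avoids W t.+1 `&` [set w | b (mp_X X t.+1 w)])).
    rewrite setIC -integral_indic//.
      exact: measurable_avoids.
    exact: (@measurable_mp_X t.+1 b).
  rewrite [LHS]mk; apply: eq_integral => w _.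
  by rewrite /kernel_op integral_indic// setIT.
Qed.

Lemma probability_avoids W t (b : set (borel_rV R d)) y : D y ->
  measurable W -> measurable b ->
  mp_proba X y (avoids W t `&` (mp_X X t @^-1` b)) =
  iter t (killed_op (mp_kernel X) W) (fun x => (\1_b x)%:E) y.
Proof.
move=> Dy mW mb; rewrite -integral_avoids//; last exact: ge0_mfun_indic.
rewrite setIC -integral_indic//; first exact: measurable_avoids.
exact: measurable_mp_X.
Qed.

Lemma measurable_hit W t (b : set (borel_rV R d)) :
  measurable W -> measurable b ->
  measurable (avoids W t `&` (mp_X X t @^-1` b)).
Proof.
move=> mW mb; apply: measurableI; first exact: measurable_avoids.
exact: measurable_mp_X.
Qed.

(** As [A] is avoided up to some visit to [G], the first visit to [G] is also the first visit to the
    union of [A] and [G]. *)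
Lemma enters_beforeE A G : enters_before X G A =
  \bigcup_t (avoids (A `|` G) t `&` (mp_X X t @^-1` (G `\` A))).
Proof.
apply/seteqP; split => w; last first.
  move=> [t _ [avt [Gt At]]]; exists t => // k.
  by rewrite leq_eqVlt => /predU1P[->//|/avt h] Ak; apply: h; left.
move=> [i Gi Ai].
have exG : exists t, `[< G (mp_X X t w) >] by exists i; exact/asboolP.
case: (ex_minnP exG) => t /asboolP Gt tmin; exists t => //; split.
  move=> k kt [Ak|/asboolP/tmin]; last by rewrite leqNgt kt.
  have ti : (t <= i)%N by apply: tmin; exact/asboolP.
  exact: (Ai k (ltnW (leq_trans kt ti))).
by split => //; apply: Ai; apply: tmin; exact/asboolP.
Qed.

Lemma measurable_enters_before A G : measurable A -> measurable G ->
  measurable (enters_before X G A).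
Proof.
move=> mA mG; rewrite enters_beforeE; apply: bigcup_measurable => t _.
by apply: measurable_hit; [exact: measurableU|exact: measurableD].
Qed.

(** Reduces eventual entrance to finite horizons: countable subadditivity bounds its probability by
    the series over the entrance time, whose partial sums are the [entrance] functions. *)
Lemma probability_enters_before A G y c e : D y ->
  measurable A -> measurable G -> (0 <= c)%R ->
  (forall n, c%:E * entrance (mp_kernel X) A G n y <= e) ->
  c%:E * mp_proba X y (enters_before X G A) <= e.
Proof.
move=> Dy mA mG c0 he.
have mW : measurable (A `|` G) by exact: measurableU.
have mGA : measurable (G `\` A) by exact: measurableD.
have le_series : mp_proba X y (enters_before X G A) <= \sum_(0 <= t <oo)
    mp_proba X y (avoids (A `|` G) t `&` (mp_X X t @^-1` (G `\` A))).
  apply: measure_sigma_subadditive; last by rewrite enters_beforeE.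
    by move=> t; exact: measurable_hit.
  exact: measurable_enters_before.
apply: le_trans (lee_wpmul2l _ le_series) _ => //.
under eq_eseriesr do rewrite probability_avoids//.
have cvgs : c%:E * entrance (mp_kernel X) A G n y @[n --> \oo] -->
    c%:E * \sum_(0 <= t <oo)
      iter t (killed_op (mp_kernel X) (A `|` G))
        (fun x => (\1_(G `\` A) x)%:E) y.
  apply: cvgeZl => //; apply: is_cvg_nneseries => n _ _.
  exact: (ge0_mfun_iter_killed _ _ mW (ge0_mfun_indic mGA)).1.
rewrite -(cvg_lim _ cvgs)//; apply: lime_le.
  by apply/cvg_ex; eexists; exact: cvgs.
exact: nearW.
Qed.

End process_law.

(** * Genealogy of the particles *)

Lemma first_time_Some (P : set nat) t :
  first_time P = Some t <-> P t /\ forall k, P k -> (t <= k)%N.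
Proof.
rewrite /first_time; case: xgetP => [_ -> [i [Pi imin] <-]|nP].
  split=> [[<-]//|[Pt tmin]]; congr Some; apply/eqP.
  by rewrite eqn_leq imin// tmin.
by split => // -[Pt tmin]; exfalso; apply: (nP (Some t)); exists t.
Qed.

Section particle_structure.
Context {R : realType} {d : nat} (A : set 'rV[R]_d) (C : nat -> set 'rV[R]_d).
Context {S : splitting_mechanism R} (l : nat) (x0 : 'rV[R]_d).
Notation label := (seq 'I_(sm_R S)).

Section runs.
Context {T : Type} (Z : label -> nat -> T -> 'rV[R]_d).
Variable M : label -> T -> 'I_(sm_J S).
Local Notation exists_particle := (exists_particle A C l x0 Z M).
Local Notation position := (position A C l x0 Z M).

(** The children of [v] form generation [(size v).+1], whence the successor. *)
Definition target (v : label) : set 'rV[R]_d := C (l - (size v).+1).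

(** The run of [v] stops at time [t] and may have offspring. Unlike [first_time], this form is
    visibly built from countably many events of the run. *)
Definition hits (v : label) (t : nat) : set T :=
  [set w | (forall i, (i < t)%N -> ~ (A `|` target v) (Z v i w)) /\
           (target v `\` A) (Z v t w)].

Lemma hits_first_time v t w : hits v t w ->
  first_time [set i | (A `|` target v) (Z v i w)] = Some t.
Proof.
move=> [avt [Ct _]]; apply/first_time_Some; split; first by right.
by move=> k Wk; rewrite leqNgt; apply/negP => /avt.
Qed.

Lemma exists_particle_consP k v w : exists_particle (k :: v) w <->
  exists_particle v w /\ (k < sm_r (M v w))%N /\ exists t, hits v t w.
Proof.
rewrite /exists_particle /=; case: (particle _ _ _ _ _ _ w v) => [[xi wt]|/=];
  last by split => // -[].
split=> [|[_ [kr [t ht]]]]; last first.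
  rewrite /offspring (hits_first_time ht).
  case: asboolP => [|_]; first by move: ht => [_ []].
  by case: insubP => //; rewrite kr.
rewrite /offspring; case E : (first_time _) => [t|//].
case: asboolP => // At; case: insubP => // i kr _ _; split => //; split => //.
exists t; move/first_time_Some: E => [[//|Ct] tmin]; split => //.
by move=> i0 it /tmin; rewrite leqNgt it.
Qed.

Lemma position_cons k v w t : exists_particle (k :: v) w -> hits v t w ->
  position (k :: v) w = Z v t w.
Proof.
rewrite /exists_particle /position /=.
case: (particle _ _ _ _ _ _ w v) => [[xi wt]|//] + ht.
rewrite /offspring (hits_first_time ht).
by case: asboolP => // _; case: insubP.
Qed.

Lemma position_none v w : ~ exists_particle v w -> position v w = x0.
Proof.
by rewrite /exists_particle /position /=; case: particle => [[xi wt] /(_ isT)|].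
Qed.

Lemma exists_particle_nil : exists_particle [::] = setT.
Proof. by apply/seteqP; split. Qed.

Lemma position_in (D : set 'rV[R]_d) v w : D x0 -> (forall j, C j `<=` D) ->
  exists_particle v w -> D (position v w).
Proof.
case: v => [//|k v] Dx0 CD ex.
have [_ [_ [t ht]]] := (exists_particle_consP k v w).1 ex.
by rewrite (position_cons ex ht); apply: CD; exact: ht.2.1.
Qed.

Lemma hits_eq v t t' w : hits v t w -> hits v t' w -> t = t'.
Proof. by move=> /hits_first_time + /hits_first_time => -> []. Qed.

End runs.

Section measurability.
Context {disp : measure_display} {T : measurableType disp}.
Variables (Z : label -> nat -> T -> 'rV[R]_d) (M : label -> T -> 'I_(sm_J S)).
Hypotheses (mA : measurable (A : set (borel_rV R d)))
  (mC : forall j, measurable (C j : set (borel_rV R d))).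
Local Notation exists_particle := (exists_particle A C l x0 Z M).

Variable v : label.
Hypotheses (mZ : forall i (a : set (borel_rV R d)), measurable a ->
    measurable (exists_particle v `&` [set w | a (Z v i w)]))
  (mM : forall j, measurable (exists_particle v `&` [set w | M v w = j])).

(** The measurability hypotheses concern only events inside [exists_particle v], so they hold both
    for the ambient sigma-algebra and for a history. Accordingly, complements are taken relative to
    [exists_particle v]. *)
Lemma measurable_exists_hits t :
  measurable (exists_particle v `&` hits Z v t).
Proof.
have -> : exists_particle v `&` hits Z v t =
    (exists_particle v `&` [set w | (target v `\` A) (Z v t w)]) `\`
    \bigcup_(i in [set i | (i < t)%N])
      (exists_particle v `&` [set w | (A `|` target v) (Z v i w)]).
  apply/seteqP; split => w.
    by move=> [ev [av Zt]]; split => // -[i it [_ /(av i it)]].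
  move=> [[ev Zt] nW]; split => //; split => // i it Wi.
  by apply: nW; exists i.
apply: measurableD.
  by apply: mZ; apply: measurableD => //; exact: mC.
apply: bigcup_measurable => i _; apply: mZ; apply: measurableU => //.
exact: mC.
Qed.

Lemma measurable_exists_cons k : measurable (exists_particle (k :: v)).
Proof.
have -> : exists_particle (k :: v) =
    (\bigcup_t (exists_particle v `&` hits Z v t)) `&`
    \big[setU/set0]_(j < sm_J S | (k < sm_r j)%N)
      (exists_particle v `&` [set w | M v w = j]).
  rewrite -bigcup_seq_cond; apply/seteqP; split => w.
    move=> /exists_particle_consP[ev [kr [t ht]]]; split; first by exists t.
    by exists (M v w) => //=; rewrite mem_index_enum.
  move=> [[t _ [ev ht]] [j /andP[_ kr] [_ Mj]]].
  apply/exists_particle_consP; rewrite Mj.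
  by split => //; split => //; exists t.
apply: measurableI.
  by apply: bigcup_measurable => t _; exact: measurable_exists_hits.
by apply: bigsetU_measurable => j _; exact: mM.
Qed.

End measurability.

(** Existence in generation [g] is decided by the runs and choices of earlier generations; this lets
    [sr_law] be applied with the existence of a particle as the conditioning event. *)
Lemma exists_particle_history {T : pointedType}
    (Z : label -> nat -> T -> 'rV[R]_d) (M : label -> T -> 'I_(sm_J S)) g v :
  measurable (A : set (borel_rV R d)) ->
  (forall j, measurable (C j : set (borel_rV R d))) -> (size v <= g)%N ->
  history A C l x0 Z M g (exists_particle A C l x0 Z M v).
Proof.
move=> mA mC; rewrite /history.
set G := (X in <<s X >>).
suff : (size v <= g)%N -> (measurable : set (set (g_sigma_algebraType G)))
  (exists_particle A C l x0 Z M v) by [].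
elim: v => [_|k v IHv /= vg].
  by rewrite exists_particle_nil; exact: measurableT.
have Gv H : (exists i, exists2 a : set (borel_rV R d), measurable a &
      H = exists_particle A C l x0 Z M v `&` [set w | a (Z v i w)]) \/
    (exists j, H = exists_particle A C l x0 Z M v `&` [set w | M v w = j]) ->
    (measurable : set (set (g_sigma_algebraType G))) H.
  by move=> GH; apply: sub_sigma_algebra; exists v.
apply: (@measurable_exists_cons _ (g_sigma_algebraType G)) => //.
- by move=> i a ma; apply: Gv; left; exists i, a.
- by move=> j; apply: Gv; right; exists j.
Qed.

End particle_structure.
(** Distributivity, with tuples viewed as functions on ['I_g]. It turns a sum over all labels of
    generation [g] into a power of the mean offspring number. *)
Lemma sum_prod_tuple (R : comNzRingType) (I : finType) (c : I -> R) g :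
  \sum_(u : g.-tuple I) \prod_(k <- u) c k = (\sum_k c k) ^+ g.
Proof.
have -> : (\sum_k c k) ^+ g = \prod_(i < g) \sum_k c k.
  by rewrite prodr_const card_ord.
rewrite bigA_distr_bigA /=.
rewrite (reindex (fun f : {ffun 'I_g -> I} => [tuple f i | i < g])) /=.
  apply: eq_bigr => f _; rewrite big_map.
  by rewrite -(big_enum _ _ _ (fun i => c (f i))).
exists (fun u : g.-tuple I => [ffun i => tnth u i]) => [f _|u _].
  by apply/ffunP => i; rewrite ffunE tnth_mktuple.
by apply: eq_from_tnth => i; rewrite tnth_mktuple ffunE.
Qed.

(** * Lower bounds for the expected population *)

Section splitting_law.
Context {R : realType} {d : nat} {D : set 'rV[R]_d}.
Variables (X : markov_process D) (A : set 'rV[R]_d) (C : nat -> set 'rV[R]_d).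
Variables (S : splitting_mechanism R) (l : nat) (x0 : 'rV[R]_d).
Variable rho : splitting_run X A C S l x0.
Hypotheses (mA : measurable (A : set (borel_rV R d)))
  (mC : forall j, measurable (C j : set (borel_rV R d)))
  (CD : forall j, C j `<=` D) (Dx0 : D x0).
Notation label := (seq 'I_(sm_R S)).
Notation P := (sr_proba rho).
Notation Z := (@sr_Z _ _ _ _ _ _ _ _ _ rho).
Notation M := (@sr_M _ _ _ _ _ _ _ _ _ rho).
Notation ex := (exists_particle A C l x0 Z M).
Notation pos := (position A C l x0 Z M).
Notation tgt := (target C (S := S) l).
Notation hit := (hits A C l Z).
Notation K := (mp_kernel X).
Implicit Types (v u : label) (f : borel_rV R d -> \bar R).

Let mtgt v : measurable (tgt v : set (borel_rV R d)).
Proof. exact: mC. Qed.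

Lemma measurable_run v i (b : set (borel_rV R d)) : measurable b ->
  measurable (Z v i @^-1` b).
Proof. by move=> mb; rewrite -[_ @^-1` _]setTI; exact: sr_Z_measurable. Qed.

Lemma measurable_exists_particle v : measurable (ex v).
Proof.
elim: v => [|k v IHv].
  by rewrite exists_particle_nil; exact: measurableT.
apply: measurable_exists_cons => //.
- by move=> i a ma; apply: measurableI => //; exact: (@measurable_run v i a).
- by move=> j; apply: measurableI => //; exact: sr_M_measurable.
Qed.

Lemma measurable_hit_particle v t : measurable (ex v `&` hit v t).
Proof.
apply: measurable_exists_hits => // i a ma.
apply: measurableI; first exact: measurable_exists_particle.
exact: (@measurable_run v i a).
Qed.

Lemma measurable_position v :
  measurable_fun [set: sr_space rho] (pos v : _ -> borel_rV R d).
Proof.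
case: v => [|k v]; first exact: measurable_cst.
move=> _ b mb; rewrite setTI.
have -> : pos (k :: v) @^-1` b =
    (\bigcup_t (ex (k :: v) `&` (ex v `&` hit v t) `&` (Z v t @^-1` b)))
    `|` (~` ex (k :: v) `&` [set _ | b x0]).
  apply/seteqP; split => w /=.
    move=> bw; have [e|ne] := pselect (ex (k :: v) w); last first.
      by right; split => //; rewrite -(position_none ne).
    have [ev [_ [t ht]]] := (exists_particle_consP _ _ _ _ _ _ _ _ _).1 e.
    by left; exists t => //; split => //=; rewrite -(position_cons e ht).
  move=> [[t _ [[e [_ ht]] bZ]]|[ne bx]]; first by rewrite (position_cons e ht).
  by rewrite (position_none ne).
apply: measurableU.
  apply: bigcup_measurable => t _; apply: measurableI.
    apply: measurableI; first exact: measurable_exists_particle.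
    exact: measurable_hit_particle.
  exact: measurable_run.
apply: measurableI.
  by apply: measurableC; exact: measurable_exists_particle.
have [bx|nbx] := pselect (b x0).
  rewrite (_ : [set _ | _] = setT); first exact: measurableT.
  by apply/seteqP; split.
rewrite (_ : [set _ | _] = set0); first exact: measurable0.
by apply/seteqP; split.
Qed.

Local Open Scope ereal_scope.

Lemma probability_run v j t (W b : set (borel_rV R d)) : (size v < l)%N ->
  measurable W -> measurable b ->
  P (ex v `&` [set w | (forall i, (i < t)%N -> ~ W (Z v i w)) /\ b (Z v t w)]
          `&` [set w | M v w = j]) =
  (sm_q j)%:E * \int[P]_(w in ex v)
    iter t (killed_op K W) (fun x => (\1_b x)%:E) (pos v w).
Proof.
move=> vl mW mb.
(* One family of constraints, indexed by time, encodes avoiding [W] before [t] and lying in [b] at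
   [t]. *)
pose a (u : label) i : set (borel_rV R d) := if (i < t)%N then ~` W else b.
have ma u i : measurable (a u i).
  by rewrite /a; case: ifP => // _; exact: measurableC.
have hist := @exists_particle_history _ _ A C S l x0 _ Z M _ v mA mC (leqnn _).
have U1 u : u \in [:: v] -> size u = size v by rewrite inE => /eqP ->.
have H1 u : u \in [:: v] -> ex v `<=` ex u by rewrite inE => /eqP ->.
have := sr_law t (fun=> j) vl (isT : uniq [:: v]) U1 ma hist H1.
have aE T (z : nat -> T -> borel_rV R d) (w : T) :
    (forall i, (i <= t)%N -> a v i (z i w)) <->
    (forall i, (i < t)%N -> ~ W (z i w)) /\ b (z t w).
  split=> [h|[h1 h2] i].
    split=> [i it|]; last by have := h t (leqnn t); rewrite /a ltnn.
    by have := h i (ltnW it); rewrite /a it.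
  by rewrite /a leq_eqVlt => /predU1P[->|it]; rewrite ?ltnn ?it//; exact: h1.
set E1 := (X in P X = _ -> _); set E2 := (X in _ -> P X = _).
have -> : E1 = E2.
  apply/seteqP; split => w /=.
    move=> [ev /(_ v (mem_head _ _))[/(aE _ (Z v)) h Mj]]; by split.
  move=> [[ev h] Mj]; split => // u; rewrite inE => /eqP ->; split => //.
  exact/(aE _ (Z v)).
have mit := ge0_mfun_iter_killed K t mW (@ge0_mfun_indic _ _ R b mb).
move=> ->; rewrite -ge0_integralZl//; first last.
- by rewrite lee_fin; exact: sm_q_ge0.
- by move=> w _; exact: mit.1.
- apply: measurable_funTS.
  exact: (measurableT_comp mit.2 (@measurable_position v)).
- exact: measurable_exists_particle.
apply: eq_integral => w /set_mem ev; rewrite big_seq1 EFinM; congr (_ * _).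
have Dpos : D (pos v w) by exact: position_in ev.
have -> : [set eta | forall i, (i <= t)%N -> a v i (mp_X X i eta)] =
    avoids (X := X) W t `&` (mp_X X t @^-1` b).
  by apply/seteqP; split => eta /(aE _ (mp_X X)).
rewrite fineK; first by rewrite probability_avoids.
by apply: fin_num_measure; exact: measurable_hit.
Qed.

Lemma integral_run v j t f : (size v < l)%N -> ge0_mfun f ->
  \int[P]_(w in ex v `&` hit v t `&` [set w | M v w = j]) f (Z v t w) =
  (sm_q j)%:E * \int[P]_(w in ex v) iter t (killed_op K (A `|` tgt v))
    (fun x => (\1_(tgt v `\` A) x)%:E * f x) (pos v w).
Proof.
move=> vl mf.
have mW : measurable (A `|` tgt v : set (borel_rV R d)) by exact: measurableU.
have mb : measurable (tgt v `\` A : set (borel_rV R d)) by exact: measurableD.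
(* The condition at time [t] moves from the event into the test function [f']; over [E] both sides
   are then monotone functionals, and [probability_run] compares them on indicators. *)
pose E := ex v `&` [set w | forall i, (i < t)%N -> ~ (A `|` tgt v) (Z v i w)]
               `&` [set w | M v w = j].
have mE : measurable E.
  apply: measurableI; last exact: sr_M_measurable.
  have -> : ex v `&`
        [set w | forall i, (i < t)%N -> ~ (A `|` tgt v) (Z v i w)] =
      ex v `&` \bigcap_(i in [set i | (i < t)%N])
        (Z v i @^-1` (~` (A `|` tgt v))).
    by apply/seteqP; split => w [ev h]; split.
  apply: measurableI; first exact: measurable_exists_particle.
  apply: bigcap_measurableType => i _; apply: measurable_run.
  exact: measurableC.
have -> : ex v `&` hit v t `&` [set w | M v w = j] =
          E `&` (Z v t @^-1` (tgt v `\` A)).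
  apply/seteqP; split => w /=.
    by move=> [[ev [h1 h2]] Mj].
  by move=> [[[ev h1] Mj] h2].
rewrite integralI_indic.
pose f' := fun x : borel_rV R d => (\1_(tgt v `\` A) x)%:E * f x.
have mf' : ge0_mfun f' by exact: ge0_mfunM_indic.
transitivity (\int[P]_(w in E) f' (Z v t w)).
  by apply: eq_integral.
apply: (@eq_mfunct _ _ _ (fun f => \int[P]_(w in E) f (Z v t w))
  (fun f => (sm_q j)%:E * \int[P]_(w in ex v)
     iter t (killed_op K (A `|` tgt v)) f (pos v w))) => //.
- by apply: mfunct_integral => //; exact: sr_Z_measurable.
- apply: mfunctZ_comp; first exact: sm_q_ge0.
  apply: (@mfunct_comp_iter_killed _ _ _ K
    (fun f => \int[P]_(w in ex v) f (pos v w))) => //.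
  apply: mfunct_integral; first exact: measurable_exists_particle.
  exact: measurable_position.
- move=> b mb'; rewrite -probability_run//.
  transitivity (P (E `&` (Z v t @^-1` b))).
    rewrite setIC -integral_indic//; exact: measurable_run.
  congr (P _); apply/seteqP; split => w /=.
    by move=> [[[ev h1] Mj] h2].
  by move=> [[ev [h1 h2]] Mj].
Qed.

(** The probability that [r(M) > k]: given that a run reaches its target outside [A], the chance
    that the child of index [k] is born. *)
Definition child_rate (k : 'I_(sm_R S)) : R :=
  (\sum_(j < sm_J S | (k < sm_r j)%N) sm_q j)%R.

Lemma child_rate_ge0 k : (0 <= child_rate k)%R.
Proof. by apply: sumr_ge0 => j _; exact: sm_q_ge0. Qed.

(** The tail-sum formula for the expectation of [r(M)], by exchanging the two sums. *)
Lemma sum_child_rate : (\sum_k child_rate k = mean_offspring S)%R.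
Proof.
rewrite /mean_offspring /mech_mean /child_rate.
under eq_bigr do rewrite big_mkcond /=.
rewrite exchange_big /=; apply: eq_bigr => j _.
rewrite -big_mkcond sumr_const mulr_natr; congr (_ *+ _)%R.
have inj : injective (widen_ord (sm_r_le j)).
  by move=> i1 i2 /(congr1 val) /= /val_inj.
rewrite -[RHS]card_ord -(card_imset _ inj).
apply: eq_card => k; apply/idP/imsetP => [kr|[i _ ->]].
  by exists (Ordinal kr) => //; exact: val_inj.
exact: (ltn_ord i).
Qed.

(** The child [k :: v] exists whenever [v] stops on its target outside [A] at some time [t < n] with
    a choice [j] such that [k < sm_r j]. These events are disjoint, and on each of them
    [integral_run] computes the contribution. *)
Lemma integral_children v k n f : (size v < l)%N -> ge0_mfun f ->
  (child_rate k)%:E * \int[P]_(w in ex v)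
    killed_sum K (A `|` tgt v) n (fun x => (\1_(tgt v `\` A) x)%:E * f x)
      (pos v w) <=
  \int[P]_(w in ex (k :: v)) f (pos (k :: v) w).
Proof.
move=> vl mf.
have mW : measurable (A `|` tgt v : set (borel_rV R d)) by exact: measurableU.
have mb : measurable (tgt v `\` A : set (borel_rV R d)) by exact: measurableD.
have mf' := ge0_mfunM_indic mb mf.
have mpos u := mfunct_integral P (measurable_exists_particle u)
  (@measurable_position u).
have mit t := ge0_mfun_iter_killed K t mW mf'.
rewrite (mfunct_sum _ (mpos v))//.
pose s := [seq (t, j) | t <- index_iota 0 n,
             j <- [seq j <- index_enum 'I_(sm_J S) | (k < sm_r j)%N]].
pose F (p : nat * 'I_(sm_J S)) :=
  ex v `&` hit v p.1 `&` [set w | M v w = p.2].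
have mF p : measurable (F p).
  apply: measurableI; first exact: measurable_hit_particle.
  exact: sr_M_measurable.
have us : uniq s.
  apply: allpairs_uniq; first exact: iota_uniq.
    by apply: filter_uniq; exact: index_enum_uniq.
  by move=> [? ?] [? ?].
have dF : trivIset [set` s] F.
  move=> [t1 j1] [t2 j2] _ _ [w [[[_ h1] /= M1] [[_ h2] /= M2]]].
  by move: (hits_eq h1 h2) => /= ->; rewrite -M1 -M2.
have sub : \big[setU/set0]_(p <- s) F p `<=` ex (k :: v).
  rewrite -bigcup_seq => w [[t j]] /= /allpairsP[[t' j'] [_ /= jk [-> ->]]].
  move=> [[ev ht] Mj]; apply/exists_particle_consP; split => //.
  split; last by exists t'.
  by move: jk; rewrite mem_filter => /andP[]; rewrite [M v w]Mj.
have mD : measurable (\big[setU/set0]_(p <- s) F p).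
  by apply: bigsetU_measurable.
have mfp u : measurable_fun [set: sr_space rho] (fun w => f (pos u w)).
  exact: (measurableT_comp mf.2 (@measurable_position u)).
apply: le_trans; last first.
  apply: (@ge0_subset_integral _ _ _ P _ _ mD
    (measurable_exists_particle (k :: v)) (fun w => f (pos (k :: v) w))) => //.
    exact: measurable_funTS.
  by move=> w _; exact: mf.1.
rewrite ge0_integral_bigsetU//; first last.
- by move=> w _; exact: mf.1.
- exact: measurable_funTS.
rewrite big_allpairs ge0_sume_distrr; last first.
  by move=> t _; exact: (mfunct_ge0 (mpos v) (mit t)).
apply: lee_sum => t _; rewrite big_filter /child_rate -sumEFin.
rewrite ge0_sume_distrl; last by move=> j _; rewrite lee_fin; exact: sm_q_ge0.
rewrite le_eqVlt; apply/orP; left; apply/eqP; apply: eq_bigr => j kj.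
rewrite -integral_run//; apply: eq_integral => w /set_mem[[ev ht] Mj].
rewrite (position_cons _ ht)//; apply/exists_particle_consP; split => //.
by split; [rewrite [M v w]Mj|exists t].
Qed.

Variable G : set (borel_rV R d).
Hypothesis mG : measurable G.

(** Induction along the ancestral line: [entrance_via] makes the process pass through the target of
    the parent, and [integral_children] restarts it from the child. The range of [i] consists of the
    targets of the ancestors of [u]. *)
Lemma integral_entrance u n : (size u <= l)%N ->
  (forall i, (l - size u <= i < l)%N -> G `<=` C i) ->
  ((\prod_(k <- u) child_rate k)%:E * entrance K A G n x0 <=
   \int[P]_(w in ex u) entrance K A G n (pos u w)).
Proof.
elim: u => [_ _|k v IHv /= vl GC].
  rewrite big_nil mul1e exists_particle_nil.
  rewrite (_ : integral _ _ _ = \int[P]_w cst (entrance K A G n x0) w)//.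
  by rewrite integral_cst//= probability_setT mule1.
have mh := ge0_mfun_entrance K mA mG n.
have c0 : 0 <= (child_rate k)%:E by rewrite lee_fin child_rate_ge0.
apply: le_trans (integral_children k n vl mh).
rewrite big_cons EFinM -muleA; apply: lee_wpmul2l => //.
apply: le_trans (IHv (ltnW vl) _) _ => [i /andP[li il]|].
  by apply: GC; rewrite il (leq_trans _ li)// leq_sub2l.
apply: (mfunct_le (mfunct_integral P (measurable_exists_particle v)
  (@measurable_position v))) => // [|x].
  apply: ge0_mfun_killed_sum; first exact: measurableU.
  by apply: ge0_mfunM_indic => //; exact: measurableD.
apply: entrance_via => //; apply: GC; rewrite leqnn /=.
by rewrite ltn_subrL (leq_ltn_trans _ vl).
Qed.

Lemma probability_exists u n : (size u <= l)%N ->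
  (forall i, (l - size u <= i < l)%N -> G `<=` C i) ->
  (\prod_(k <- u) child_rate k)%:E * entrance K A G n x0 <= P (ex u).
Proof.
move=> ul GC; apply: le_trans (integral_entrance n ul GC) _.
have mh := ge0_mfun_entrance K mA mG n.
have m1 : ge0_mfun (cst 1 : borel_rV R d -> \bar R).
  by split => //; exact: measurable_cst.
apply: le_trans (mfunct_le (mfunct_integral P (measurable_exists_particle u)
  (@measurable_position u)) mh m1 _) _ => [y|].
  exact: entrance_le1.
by rewrite integral_cst ?mul1e//; exact: measurable_exists_particle.
Qed.

(** Generation [g] alone suffices: summing [probability_exists] over its labels, the products of
    child rates add up to the power of the mean offspring number. *)
Lemma expected_total_ge g : (g <= l)%N ->
  (forall i, (l - g <= i < l)%N -> G `<=` C i) ->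
  (mean_offspring S ^+ g)%:E * mp_proba X x0 (enters_before X G A) <=
  expected_total rho.
Proof.
move=> gl GC.
have mo0 : (0 <= mean_offspring S)%R.
  by rewrite -sum_child_rate; apply: sumr_ge0 => k _; exact: child_rate_ge0.
apply: probability_enters_before => //; first exact: exprn_ge0.
move=> n; rewrite -sum_child_rate -sum_prod_tuple.
have popE h w : (population A C l x0 Z M h w)%:R%:E =
    \sum_(u : h.-tuple 'I_(sm_R S)) (\1_(ex u) w)%:E :> \bar R.
  rewrite /population -sum1_card natr_sum big_mkcond /= sumEFin.
  congr EFin; apply: eq_bigr => u _; rewrite indicE.
  have -> : (u \in in_set [set u : h.-tuple _ |
                isSome (particle A C l x0 Z M w u)]) = (w \in ex u).
    by apply/idP/idP => /set_mem h'; apply/mem_set.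
  by case: ifP.
have m1 u : ge0_mfun (fun w => (\1_(ex u) w)%:E : \bar R).
  by apply: ge0_mfun_indic; exact: measurable_exists_particle.
have mI := mfunct_integral P measurableT (@measurable_id _ (sr_space rho) setT).
have mpop h : ge0_mfun (fun w => (population A C l x0 Z M h w)%:R%:E : \bar R).
  under eq_fun do rewrite popE.
  by apply: ge0_mfun_sum.
apply: (@le_trans _ _ (\int[P]_w (population A C l x0 Z M g w)%:R%:E)).
  under eq_integral do rewrite popE.
  rewrite (mfunct_sum _ mI)//= -sumEFin ge0_sume_distrl; last first.
    move=> u _; rewrite lee_fin; apply: prodr_ge0 => k _.
    exact: child_rate_ge0.
  apply: lee_sum => u _.
  rewrite integral_indic ?setIT//; last exact: measurable_exists_particle.
  by apply: probability_exists; rewrite size_tuple.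
rewrite /expected_total unlock.
under [leRHS]eq_integral.
  move=> w _; rewrite /total_population natr_sum -sumEFin; over.
rewrite (mfunct_sum _ mI)//= (bigD1_seq g)//=; last 2 first.
- by rewrite mem_index_iota leq0n ltnS.
- exact: (iota_uniq 0 l.+1).
by rewrite leeDl//; apply: sume_ge0 => h _; exact: (mfunct_ge0 mI (mpop h)).
Qed.

End splitting_law.

(** * Levels of the importance function *)

Section levels.
Context {R : realType} {d : nat} (D B : set 'rV[R]_d).
Variables (V : 'rV[R]_d -> R) (Delta : R).
Hypotheses (D_open : open D) (B_sub : B `<=` D)
  (V_continuous : {within D, continuous V}) (Delta_gt0 : 0 < Delta).

Lemma cvg_importance y : D y -> V z @[z --> y] --> V y.
Proof.
move=> Dy; have := V_continuous; rewrite continuous_open_subspace// => /(_ y).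
by apply; exact: mem_set.
Qed.

Lemma level_set_sub n j : level_set D B V Delta n j `<=` D.
Proof. by case: j => [|j] //= y []. Qed.

Lemma measurable_level_set n j : measurable (B : set (borel_rV R d)) ->
  measurable (level_set D B V Delta n j : set (borel_rV R d)).
Proof.
move=> mB; case: j => [//|j]; rewrite /level_set.
set c := _ / _.
(* Continuity of [V] is known only on [D], so the sublevel set is written as a difference of two
   open sets. *)
have -> : [set y | D y /\ V y <= c] = D `\` (D `&` [set y | c < V y]).
  apply/seteqP; split => y /=.
    by move=> [Dy Vy]; split => // -[_]; rewrite ltNge Vy.
  by move=> [Dy nV]; split => //; rewrite leNgt; apply/negP => cV; exact: nV.
apply: measurableD; apply: open_borel => //.
rewrite openE => y [Dy cVy]; apply: filterI; first exact: open_nbhs_nbhs.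
exact: (cvgr_gt _ (cvg_importance Dy)).
Qed.

(** Level [0] is [B], so outside [B] the level is a successor. *)
Lemma level_succ n z : (0 < n)%N -> D z -> ~ B z ->
  exists2 j, level D B V Delta n z = j.+1 & V z <= j%:R * Delta / n%:R.
Proof.
move=> n0 Dz nBz.
have exj : exists j, `[< level_set D B V Delta n j z >].
  (* One successor rounds up; the other is the index shift, level [j.+1] having threshold
     [j * Delta / n]. *)
  exists (Num.truncn (V z / (Delta / n%:R))).+2; apply/asboolP; split => //.
  rewrite -mulrA -ler_pdivrMr ?divr_gt0// ?ltr0n//.
  exact/ltW/truncnS_gt.
case: (ex_minnP exj) => j /asboolP zj jmin.
have lE : level D B V Delta n z = j.
  rewrite /level (_ : first_time _ = Some j)//; apply/first_time_Some.
  by split => // k zk; apply: jmin; exact/asboolP.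
case: j zj jmin lE => [//|j] [_ Vz] _ lE; by exists j.
Qed.

End levels.

(** * Exponential growth rates *)

Section rates.
Context {R : realType}.
Local Open Scope ereal_scope.
Implicit Types (u : (\bar R)^nat) (c : \bar R).

Lemma lt_limn_einf u c : c < limn_einf u -> \forall n \near \oo, c < u n.
Proof.
rewrite /limn_einf lteNr => /ereal_inf_lt[_ [U nU <-]] supU.
apply: filterS nU => n Un; rewrite -lteN2; apply: le_lt_trans supU.
by apply: ereal_sup_ubound; exists n.
Qed.

Lemma limn_esup_ge u c : (\forall n \near \oo, c <= u n) -> c <= limn_esup u.
Proof.
move=> nc; apply: le_ereal_inf_tmp => _ [U nU <-].
have [n [Un cn]] := filter_ex (filterI nU nc).
by apply: le_trans cn _; apply: ereal_sup_ubound; exists n.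
Qed.

Lemma action_cost_ge0 {d : nat} (D : set 'rV[R]_d)
    (L : 'rV[R]_d -> 'rV[R]_d -> \bar R) y z :
  (forall y v, 0 <= L y v) -> 0 <= action_cost D L y z.
Proof.
move=> L0; apply: le_ereal_inf_tmp => _ [t [phi [_ _ _ ->]]].
by apply: integral_ge0.
Qed.

(* [lne 0 = -oo], so a finite lower bound on the rate makes [p n] positive. *)
Lemma exp_rate_ge (p T : nat -> \bar R) n (c m : R) g : (0 < n)%N ->
  p n <= 1 -> c%:E < exp_rate p n -> (1 < m)%R ->
  (m ^+ g)%:E * p n <= T n ->
  (c + g%:R * ln m / n%:R)%:E <= exp_rate T n.
Proof.
move=> n0 p1 cp m1 pT.
have ni : (0 < n%:R^-1 :> R)%R by rewrite invr_gt0 ltr0n.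
have m0 : (0 < m)%R by exact: lt_trans m1.
have mg0 : (0 < m ^+ g)%R by exact: exprn_gt0.
case E : (p n) p1 cp pT => [q| |] //; last first.
  by rewrite /exp_rate E /= gt0_muleNy.
move=> q1; rewrite /exp_rate E; have [q0|q0] := leP q 0%R.
  by rewrite le0_lneNy// gt0_muleNy.
rewrite lne_EFin// -EFinM lte_fin => cq; rewrite -EFinM => qT.
have Tge : lne (m ^+ g * q)%:E <= lne (T n).
  rewrite lee_lne// in_itv/= leey andbT.
    by rewrite lee_fin mulr_ge0// ltW.
  by apply: le_trans qT; rewrite lee_fin mulr_ge0// ltW.
apply: le_trans (lee_wpmul2l _ Tge); last by rewrite lee_fin ltW.
rewrite lne_EFin ?mulr_gt0// -EFinM lee_fin lnM ?posrE// lnXn//.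
rewrite -[(ln m *+ g)%R]mulr_natl.
by rewrite mulrDr addrC lerD ?(ltW cq)// mulrC.
Qed.

End rates.

(** * Instability of the algorithm *)

Lemma ltn_of_subn_sub (i j k : nat) :
  (j.+1 - (j - k) <= i)%N -> (i < j.+1)%N -> (k < i)%N.
Proof. lia. Qed.

Lemma lerB_natr (R : numDomainType) (j k : nat) :
  j%:R - k%:R <= (j - k)%:R :> R.
Proof. by rewrite lerBlDr -natrD ler_nat addnC -leq_subLR. Qed.

Theorem proposition6 (R : realType) (d : nat) (D A B : set 'rV[R]_d)
  (D_open : open D) (D_connected : connected D)
  (A_sub : A `<=` D) (B_sub : B `<=` D) (AB_disjoint : A `&` B = set0)
  (A_measurable : measurable (A : set (borel_rV R d)))
  (B_measurable : measurable (B : set (borel_rV R d)))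
  (X : nat -> markov_process D)
  (L : 'rV[R]_d -> 'rV[R]_d -> \bar R) (L_ge0 : forall y v, (0 <= L y v)%E)
  (V : 'rV[R]_d -> R) (V_continuous : {within D, continuous V})
  (V_B : forall y, B y -> V y <= 0)
  (Delta : R) (Delta_gt0 : 0 < Delta)
  (S : splitting_mechanism R) (S_unbiased : unbiased S) :
  let J := action_cost D L in
  let Wbar := fun y : 'rV[R]_d => ln (mean_offspring S) / Delta * V y in
  forall (x : 'rV[R]_d) (x_ : nat -> 'rV[R]_d),
  (D `\` (A `|` B)) x -> 0 <= V x ->
  (forall n, (D `\` (A `|` B)) (x_ n)) -> x_ n @[n --> \oo] --> x ->
  forall y : 'rV[R]_d,
  (D `\` (A `|` B)) y -> 0 < Wbar y ->
  (J x y < (Wbar x - Wbar y)%:E)%E ->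
  J x z @[z --> within D (nbhs y)] --> J x y ->
  (forall delta : R, 0 < delta ->
    (- ereal_inf [set J x z | z in D `&` eball y delta] <=
     limn_einf (exp_rate (fun n =>
       mp_proba (X n) (x_ n) (enters_before (X n) (eball y delta) A))))%E) ->
  forall run : (forall n, splitting_run (X n) A (level_set D B V Delta n) S
                            (level D B V Delta n (x_ n)) (x_ n)),
  ~ stable (fun n => expected_total (run n)).
Proof.
move=> J Wbar x x_ [Dx ABx] Vx0 x_DAB cvx y [Dy ABy] Wy0 JW _ Hp run stab.
pose m := mean_offspring S; pose a := ln m / Delta.
have J0 z : (0 <= J x z)%E by exact: action_cost_ge0.
have Jfin : J x y \is a fin_num.
  by rewrite ge0_fin_numE// (lt_trans JW)// ltry.
pose r := fine (J x y); have JE : J x y = r%:E by rewrite fineK.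
have r0 : 0 <= r by rewrite fine_ge0.
have rW : r < a * V x - a * V y by move: JW; rewrite JE lte_fin.
have aVy : 0 < a * V y by exact: Wy0.
(* If [a <= 0], then [V x >= 0] gives [a * V x <= 0], whereas [a * V x] exceeds the sum of [r >= 0]
   and [a * V y > 0]. *)
have a0 : 0 < a.
  rewrite ltNge; apply/negP => aN.
  have : a * V x <= 0 by rewrite mulr_le0_ge0.
  lra.
have Vy0 : 0 < V y by move: aVy; rewrite pmulr_rgt0.
have lnm0 : 0 < ln m by move: a0; rewrite /a pmulr_lgt0 ?invr_gt0.
have m1 : 1 < m.
  by rewrite ltNge; apply/negP => /ln_le0; rewrite leNgt lnm0.
(* The gap is split into quarters: one for the probability estimate, one ([2 * a * e]) for the
   variation of [V] near [x] and [y], one for rounding the level indices, and one left as the growth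
   rate. *)
pose gap := a * (V x - V y) - r.
have gap0 : 0 < gap by rewrite /gap mulrBr; lra.
pose e := gap / (8%:R * a).
have e0 : 0 < e by rewrite divr_gt0// mulr_gt0.
have aeE : a * e = gap / 8%:R by rewrite /e; field; rewrite gt_eqF.
have [delta delta0 Vdelta] :
    exists2 delta, 0 < delta & eball y delta `<=` [set z | V z < V y + e].
  apply: nbhs_eball; apply: (cvgr_lt _ (cvg_importance D_open V_continuous Dy)).
  by rewrite ltrDl.
(* The process stays in [D], so entering [G] and entering the ball are the same event; level sets of
   positive index are subsets of [D] and can only contain [G]. *)
pose G := D `&` eball y delta.
have mG : measurable (G : set (borel_rV R d)).
  by apply: open_borel; apply: openI => //; exact: open_eball.
pose p n := mp_proba (X n) (x_ n) (enters_before (X n) (eball y delta) A).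
pose Tn n := expected_total (run n).
have near_p : \forall n \near \oo, ((- r - gap / 4%:R)%:E < exp_rate p n)%E.
  apply: lt_limn_einf; apply: lt_le_trans (Hp delta delta0).
  apply: (@lt_le_trans _ _ (- (J x y))%E).
    by rewrite JE -EFinN lte_fin; lra.
  rewrite leeN2; apply: ereal_inf_lbound; exists y => //; split => //.
  exact: eball_center.
have near_V : \forall n \near \oo, V x - e < V (x_ n).
  apply: (cvgr_gt _ (cvg_comp _ _ cvx
    (cvg_importance D_open V_continuous Dx))).
  by rewrite ltrBlDr ltrDl.
have near_n : \forall n \near \oo, 4%:R * ln m / gap < n%:R.
  exact: nbhs_infty_gtr.
have : ((gap / 4%:R)%:E <= limn_esup (exp_rate Tn))%E.
  apply: limn_esup_ge; near=> n.
  have nbig : 4%:R * ln m / gap < n%:R by near: n.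
  have n0R : 0 < n%:R :> R.
    by apply: lt_trans nbig; rewrite divr_gt0// mulr_gt0.
  have n0 : (0 < n)%N by move: n0R; rewrite ltr0n.
  have Vxn : V x - e < V (x_ n) by near: n.
  have pn : ((- r - gap / 4%:R)%:E < exp_rate p n)%E by near: n.
  have [Dxn ABxn] := x_DAB n.
  have nBxn : ~ B (x_ n) by move=> Bx; apply: ABxn; right.
  have [j lE Vj] := level_succ V Delta_gt0 n0 Dxn nBxn.
  (* With threshold [i0 * Delta / n] above [V y + e], every level of index greater than [i0]
     contains [G]. *)
  have [i0 i0gt i0le] : exists2 i0, (V y + e) * n%:R / Delta < i0%:R &
      i0%:R <= (V y + e) * n%:R / Delta + 1.
    have q0 : 0 <= (V y + e) * n%:R / Delta.
      by rewrite divr_ge0 ?mulr_ge0 ?addr_ge0 ?ltW.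
    have /andP[qle qgt] := truncn_itv q0.
    exists (Num.truncn ((V y + e) * n%:R / Delta)).+1 => //.
    by rewrite -natr1 lerD2r.
  (* Starting at level [j.+1], the first [g] generations of offspring stop on levels of index
     greater than [i0]. If [j <= i0], then [g = 0] and the lower bound [j - i0] on [g] still
     holds. *)
  pose g := (j - i0)%N.
  have pE : p n = mp_proba (X n) (x_ n) (enters_before (X n) G A).
    congr (mp_proba _ _ _); apply/seteqP; split => w [i Gi nA]; exists i => //.
      by split => //; exact: mp_state.
    by case: Gi.
  have pT : ((m ^+ g)%:E * p n <= Tn n)%E.
    rewrite pE; apply: expected_total_ge => //.
    - by move=> k; exact: measurable_level_set.
    - by move=> k; exact: level_set_sub.
    - by rewrite lE; apply: leq_trans (leq_subr _ _) _.
    - rewrite lE => i /andP[gi ij] z [Dz zy].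
      have : (i0 < i)%N := ltn_of_subn_sub gi ij.
      case: i {gi ij} => [//|i] i0i; split => //.
      apply: ltW; apply: lt_le_trans (Vdelta _ zy) _.
      rewrite ler_pdivlMr// -ler_pdivrMr//; apply: le_trans (ltW i0gt) _.
      by rewrite ler_nat.
  have p1 : (p n <= 1)%E.
    by rewrite pE; apply: probability_le1; exact: measurable_enters_before.
  apply: le_trans (exp_rate_ge n0 p1 pn m1 pT).
  rewrite lee_fin.
  have gge : j%:R - i0%:R <= g%:R :> R.
    exact: lerB_natr.
  have jge : (V x - e) * n%:R / Delta <= j%:R.
    rewrite ler_pdivrMr// -ler_pdivlMr//; exact: ltW (lt_le_trans Vxn Vj).
  (* The term [n%:R^-1] is the cost of rounding [i0] up by at most one. *)
  have gn : (V x - V y - 2%:R * e) / Delta - n%:R^-1 <= g%:R / n%:R.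
    rewrite ler_pdivlMr// mulrBl mulVf ?gt_eqF//.
    have -> : (V x - V y - 2%:R * e) / Delta * n%:R =
      (V x - e) * n%:R / Delta - (V y + e) * n%:R / Delta.
      by field; rewrite gt_eqF.
    lra.
  have lnn : ln m / n%:R <= gap / 4%:R.
    by move: nbig; rewrite ltr_pdivrMr// ler_pdivrMr//; lra.
  have : ln m * ((V x - V y - 2%:R * e) / Delta - n%:R^-1) <=
         ln m * (g%:R / n%:R) by rewrite ler_pM2l.
  have -> : ln m * ((V x - V y - 2%:R * e) / Delta - n%:R^-1) =
     a * (V x - V y) - 2%:R * (a * e) - ln m / n%:R.
    by rewrite /a; field; rewrite !gt_eqF.
  have -> : ln m * (g%:R / n%:R) = g%:R * ln m / n%:R by rewrite mulrCA mulrA.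
  by rewrite aeE; move: lnn; rewrite /gap; lra.
move=> /le_trans /(_ stab); rewrite lee_fin leNgt => /negP; apply.
by rewrite divr_gt0.
Unshelve. all: by end_near.
Qed.
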